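(* There exists an absolute constant $c>0$ such that for all integers $k\ge 2$ and $\Delta$: if $1\le\Delta\le\frac k2$ then $n^*(k,\Delta)\ge c\,\frac{k-2\Delta}{\sqrt k}$; and if $1\le\Delta<\frac k4$ then $$n^*(k,\Delta)\ge c\,k\,\mathrm{arccosh}\Big(1+\frac{k}{4\Delta^2}\Big).$$ Moreover, $k\,\mathrm{arccosh}(1+\frac{k}{4\Delta^2})$ is within absolute constant factors of $k\log(1+\frac{k}{\Delta^2})$ when $\Delta\le\sqrt k$ and of $\frac{k^{3/2}}{\Delta}$ when $\Delta\ge\sqrt k$.
   Context: For an urn of $k$ colored balls let $C$ be its number of distinct colors. The sample complexity $n^*(k,\Delta)$ is the minimal integer $n$ such that there exists an integer-valued estimator $\hat C$ based on $n$ balls drawn independently and uniformly with replacement from the urn such that $\mathbb{P}[|\hat C-C|\ge\Delta]\le0.1$ for every urn containing $k$ balls. *)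

(* Defs.v *)
From Stdlib Require Import Reals ClassicalEpsilon.
From mathcomp Require Import all_boot all_algebra.
Set Implicit Arguments. Unset Strict Implicit. Unset Printing Implicit Defensive.
Import GRing.Theory Num.Theory.

(* An urn of k balls: ball i : 'I_k has colour u i (colours are natural numbers). *)
Definition num_colors (k : nat) (u : {ffun 'I_k -> nat}) : nat :=
  size (undup (codom u)).

(* A sample of n draws with replacement is s : {ffun 'I_n -> 'I_k} (the indices
   of the drawn balls), uniformly distributed over all k^n such functions.
   The estimator only sees the sequence of colours of the drawn balls. *)
Definition observe (k n : nat) (u : {ffun 'I_k -> nat}) (s : {ffun 'I_n -> 'I_k})
  : {ffun 'I_n -> nat} := [ffun i => u (s i)].

Definition fail_prob (k n d : nat) (u : {ffun 'I_k -> nat})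
  (est : {ffun 'I_n -> nat} -> int) : rat :=
  ((#|[set s : {ffun 'I_n -> 'I_k} |
        (d <= `|est (observe u s) - (num_colors u)%:Z|)%N]|)%:R
   / (#|{: {ffun 'I_n -> 'I_k}}|)%:R)%R.

Definition achievable (k d n : nat) : Prop :=
  exists est : {ffun 'I_n -> nat} -> int,
    forall u : {ffun 'I_k -> nat}, (fail_prob d u est <= 1 / 10%:R)%R.

Definition achb (k d n : nat) : bool :=
  if excluded_middle_informative (achievable k d n) then true else false.

(* n^*(k,d): the minimal achievable n (default 0 if none existed; it always exists). *)
Definition nstar (k d : nat) : nat :=
  match excluded_middle_informative (exists n, achb k d n) with
  | left H => ex_minn H
  | right _ => 0%N
  end.

Definition arccosh (x : R) : R := ln (x + sqrt (x * x - 1)).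

(* Main.v *)
Require Import Defs.
From Stdlib Require Import Reals Lra ClassicalEpsilon.
From mathcomp Require Import all_boot all_algebra.
From mathcomp Require Import zify.
Set Implicit Arguments. Unset Strict Implicit. Unset Printing Implicit Defensive.
Import GRing.Theory Num.Theory.

(** Partition the balls into clusters and the clusters into groups. A random bit per group
    decides whether each of its clusters is rainbow (every ball has its own colour) or
    monochromatic (all balls take the colour of one random ball of the cluster). A cluster hit
    by a single draw shows a uniformly random colour of its palette in both cases, so the bit
    of a group none of whose clusters is hit twice stays hidden: given the observation it is
    still a fair coin. If every group bit moves the number of colours by [g] and [u] bits are
    hidden, an estimator meets [C] up to [d] with probability at most
    [W / sqrt (u + 1)], where [W] is about [2 d / g].

    One group of [k - 2 d] clusters gives the birthday bound. Clusters of size two in groups of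
    [g ~ d^2 / k] clusters give [k^(3/2) / d], because only [n^2 / k] collisions occur. Singleton
    groups of pairs give [k log (k / d^2)], because about [k exp (- 2 n / k)] pairs are not hit. *)

(** * Anticoncentration of the binomial law *)

Lemma leq_bin_half u t : 'C(u, t) <= 'C(u, u./2).
Proof.
have up : forall j, j < u./2 -> 'C(u, j) <= 'C(u, j.+1).
  move=> j hj; have e := mul_bin_left u j.
  rewrite -(leq_pmul2l (ltn0Sn j)) e leq_mul2r; apply/orP; right; lia.
have mono : forall i, 'C(u, u./2 - i) <= 'C(u, u./2).
  elim=> [|i IH]; first by rewrite subn0.
  case: (leqP (u./2) i) => hi.
    by have -> : u./2 - i.+1 = u./2 - i by lia.
  apply: leq_trans IH; have -> : u./2 - i = (u./2 - i.+1).+1 by lia.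
  by apply: up; lia.
case: (leqP t u./2) => ht.
  by rewrite (_ : t = u./2 - (u./2 - t)); [exact: mono | lia].
case: (leqP t u) => htu; last by rewrite bin_small.
rewrite -bin_sub //.
by rewrite (_ : u - t = u./2 - (u./2 - (u - t))); [exact: mono | lia].
Qed.

(** Each step multiplies the left side by at most 16: ['C(2j+2, j+1)] is [2 (2j+1) / (j+1)] times
    ['C(2j, j)], and [(2j+1) (2j+3) <= 4 (j+1)^2]. *)
Lemma central_bin_sqr j : 'C(j.*2, j) ^ 2 * (j.*2).+1 <= 16 ^ j.
Proof.
elim: j => // j IH.
have e : 'C(j.+1.*2, j.+1) * j.+1 = 'C(j.*2, j) * (2 * (j.*2).+1).
  have := mul_bin_diag (j.*2).+1 j; rewrite /= => h1.
  have h2 : 'C((j.*2).+1, j) = 'C((j.*2).+1, j.+1).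
    by rewrite -bin_sub; [congr 'C(_, _); lia | lia].
  by rewrite doubleS binS h2 addnn -muln2 mulnAC [_ * j.+1]mulnC -h1 mulnAC mulnC [2 * _]mulnC.
rewrite [16 ^ _]expnS -(@leq_pmul2r (j.+1 ^ 2)) ?expn_gt0 //.
have -> : 'C(j.+1.*2, j.+1) ^ 2 * (j.+1.*2).+1 * j.+1 ^ 2 =
          ('C(j.*2, j) ^ 2 * (j.*2).+1) * (4 * (j.*2).+1 * (j.+1.*2).+1).
  by rewrite mulnAC -expnMn e; lia.
have -> : 16 * 16 ^ j * j.+1 ^ 2 = 16 ^ j * (16 * j.+1 ^ 2) by lia.
by apply: leq_mul => //; lia.
Qed.

Lemma bin_sqr_le u t : 'C(u, t) ^ 2 * u.+1 <= 4 ^ u.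
Proof.
have h := leq_bin_half u t.
apply: (@leq_trans ('C(u, u./2) ^ 2 * u.+1)); first by rewrite leq_mul2r leq_exp2r // h orbT.
have e4 : forall j, 4 ^ j.*2 = 16 ^ j by move=> j; rewrite -muln2 mulnC expnM.
rewrite -{1 3 4}(odd_double_half u); case: (odd u); last by rewrite add0n e4; apply: central_bin_sqr.
rewrite add1n /= .
set j := u./2.
have hc := central_bin_sqr j.+1.
(* For odd [u], the middle coefficient is half of the next central one, so the even bound at [j.+1]
   applies. *)
have e : 'C(j.+1.*2, j.+1) = 2 * 'C((j.*2).+1, j).
  rewrite doubleS binS; have : 'C((j.*2).+1, j.+1) = 'C((j.*2).+1, j).
    by rewrite -[RHS]bin_sub; [congr 'C(_, _); lia | lia].
  lia.
have e16 : 16 ^ j.+1 = 4 * 4 ^ (j.*2).+1 by rewrite -e4 doubleS expnS.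
by rewrite e e16 expnMn in hc; lia.
Qed.

Lemma leq_card_bigcup (I T : finType) (P : pred I) (F : I -> {set T}) :
  #|\bigcup_(i | P i) F i| <= \sum_(i | P i) #|F i|.
Proof.
elim/big_ind2: _ => [|x1 x2 y1 y2 h1 h2|//]; first by rewrite cards0.
by apply: leq_trans (leq_card_setU _ _) _; apply: leq_add.
Qed.

Lemma card_subsets_window (T : finType) (A : {set T}) (P : pred nat) (W : nat) :
  (forall t t', P t -> P t' -> t' < t + W) ->
  #|[set B : {set T} | (B \subset A) && P #|B|]| ^ 2 * #|A|.+1 <= W ^ 2 * 4 ^ #|A|.
Proof.
move=> hP; set S := [set B | _].
have hS : #|S| <= W * 'C(#|A|, #|A|./2).
  have [-> | [B0 hB0]] := set_0Vmem S; first by rewrite cards0.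
  have [|t0 ht0 min0] := @ex_minnP P.
    by exists #|B0|; move: hB0; rewrite inE => /andP[].
  have sub : S \subset \bigcup_(i < W) [set B : {set T} | B \subset A & #|B| == t0 + i].
    apply/subsetP => B; rewrite inE => /andP[BA PB]; apply/bigcupP.
    have h1 := min0 _ PB; have h2 := hP _ _ ht0 PB.
    have hi : #|B| - t0 < W by lia.
    by exists (Ordinal hi) => //; rewrite inE BA /= subnKC.
  apply: leq_trans (subset_leq_card sub) _.
  apply: leq_trans (leq_card_bigcup _ _) _.
  rewrite -[X in X * _](card_ord W) -sum_nat_const; apply: leq_sum => i _.
  by rewrite cards_draws; exact: leq_bin_half.
have h := bin_sqr_le #|A| #|A|./2.
apply: (@leq_trans ((W * 'C(#|A|, #|A|./2)) ^ 2 * #|A|.+1)).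
  by rewrite leq_mul2r leq_exp2r // hS orbT.
by rewrite expnMn -mulnA leq_mul2l h orbT.
Qed.

(** Fixing [b :\: A] fixes [F] and makes [C] affine in [#|b :&: A|] with slope [-g]. Success then
    confines this size to a window of length [W], which the central binomial bound makes
    unlikely. *)
Lemma anticoncentration (T : finType) (A : {set T}) (F : {set T} -> int)
    (C : {set T} -> nat) (g W d : nat) :
  (forall b, F b = F (b :\: A)) ->
  (forall b, C b + g * #|b :&: A| = C (b :\: A)) ->
  2 * d <= g * W + 1 -> 2 * W ^ 2 <= #|A|.+1 ->
  7 * #|[set b | (`|(F b - (C b)%:Z)%R| < d)%N]| <= 5 * 2 ^ #|T|.
Proof.
move=> hF hC hd hW; set S := [set b | _].
pose slice r := [set b in S | b :\: A == r].
have slice_le r : 7 * #|slice r| <= 5 * 2 ^ #|A|.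
  pose P t := (`|(F r - (C r)%:Z + (g * t)%:Z)%R| < d)%N.
  have hP t t' : P t -> P t' -> t' < t + W.
    rewrite /P => h1 h2; rewrite ltnNge; apply/negP => h.
    (* Success at both sizes allows [C] to vary by at most [2 * d - 2], less than [g * W]. *)
    have : g * (t + W) <= g * t' by rewrite leq_mul2l h orbT.
    by rewrite mulnDr; lia.
  have := card_subsets_window A hP.
  set N := #|[set B | _]| => hN.
  have le_N : #|slice r| <= N.
    rewrite -(@card_in_imset _ _ (fun b : {set T} => b :&: A)); last first.
      move=> b1 b2; rewrite !inE => /andP[_ /eqP e1] /andP[_ /eqP e2] e.
      by rewrite -(setID b1 A) -(setID b2 A) e e1 e2.
    apply: subset_leq_card; apply/subsetP => a /imsetP[b].
    rewrite !inE => /andP[hb /eqP er] ->; rewrite subsetIr /= /P.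
    by move: hb (hC b); rewrite hF er; lia.
  have h2 : 2 * N ^ 2 <= 4 ^ #|A|.
    case: (posnP W) => [W0 | Wpos]; first by move: hN; rewrite W0; case: (N).
    rewrite -(@leq_pmul2l (W ^ 2)) ?expn_gt0 ?Wpos //.
    by apply: leq_trans hN; rewrite mulnCA mulnA mulnC leq_mul2l hW orbT.
  apply: (@leq_trans (7 * N)); first by rewrite leq_mul2l le_N orbT.
  (* The fraction is at most [1 / sqrt 2], which is below [5/7] because 49 < 50. *)
  rewrite -leq_sqr !expnMn -[(2 ^ _) ^ 2]expnM [#|A| * 2]mulnC expnM (_ : 2 ^ 2 = 4) //; lia.
have -> : #|S| = \sum_(r in powerset (~: A)) #|slice r|.
  rewrite -sum1_card (partition_big (fun b => b :\: A) (mem (powerset (~: A)))) /=; last first.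
    by move=> b _; rewrite inE setDE subsetIr.
  by apply: eq_bigr => r _; rewrite -sum1_card; apply: eq_bigl => b; rewrite !inE.
rewrite big_distrr /=.
apply: (@leq_trans (\sum_(r in powerset (~: A)) 5 * 2 ^ #|A|)).
  by apply: leq_sum => r _; exact: slice_le.
by rewrite sum_nat_const card_powerset mulnCA -expnD addnC cardsC.
Qed.

(** * Urns with hidden group bits *)

Section Swap.
Variables (k n : nat) (J Gt : finType) (cl : 'I_k -> J) (gr : J -> Gt).
Implicit Types (b : {set Gt}) (tau : {ffun J -> 'I_k}) (s : {ffun 'I_n -> 'I_k})
  (w : {ffun J -> 'I_k} * {ffun 'I_n -> 'I_k}).

(* [b] is the set of monochromatic groups and [tau] picks the ball giving a cluster its colour. *)
Definition paint b tau (x : 'I_k) : 'I_k :=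
  if gr (cl x) \in b then tau (cl x) else x.

Definition painted_urn b tau : {ffun 'I_k -> nat} :=
  [ffun x => nat_of_ord (paint b tau x)].

Definition sections : {set {ffun J -> 'I_k}} :=
  [set tau : {ffun J -> 'I_k} | [forall j, cl (tau j) == j]].

Definition hidden_groups s : {set Gt} :=
  [set c | [forall i, forall j, (i != j) && (cl (s i) == cl (s j)) ==> (gr (cl (s i)) != c)]].

(* For the draws [i] that fall in a hidden monochromatic group, exchange the drawn ball with the
   ball whose colour its cluster carries. Both are uniform in the cluster, so the counting
   measure is preserved, and afterwards the observation no longer depends on the hidden bits
   (see [observe_swap]). *)
Definition swap_draws b w :=
  let H := b :&: hidden_groups w.2 in
  ([ffun j => if gr j \in H then
                if [pick i | cl (w.2 i) == j] is Some i then w.2 i else w.1 j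
              else w.1 j],
   [ffun i => if gr (cl (w.2 i)) \in H then w.1 (cl (w.2 i)) else w.2 i]).

Lemma hidden_groupsP s i j :
  gr (cl (s i)) \in hidden_groups s -> cl (s i) = cl (s j) -> i = j.
Proof.
rewrite inE => /forallP/(_ i)/forallP/(_ j) h e; apply/eqP/negPn/negP => ne.
by move: h; rewrite ne e !eqxx.
Qed.

(** The colours in use are the balls of rainbow groups and, disjoint from them, the chosen balls of
    the monochromatic clusters, one per cluster since [tau] is injective. *)
Lemma num_colors_painted b tau :
  tau \in sections ->
  num_colors (painted_urn b tau) =
  \sum_c (if c \in b then #|[set j | gr j == c]| else #|[set x | gr (cl x) == c]|).
Proof.
rewrite inE => /forallP htau; have tauK j : cl (tau j) = j by apply/eqP.
have tau_inj : injective tau by apply: can_inj tauK.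
pose Im := [set x | gr (cl x) \notin b] :|: [set tau j | j in [set j | gr j \in b]].
have -> : num_colors (painted_urn b tau) = #|Im|.
  rewrite /num_colors cardE -(size_map (@nat_of_ord k)); apply: perm_size.
  apply: uniq_perm; rewrite ?undup_uniq ?map_inj_uniq ?enum_uniq //; first exact: ord_inj.
  move=> v; rewrite mem_undup; apply/codomP/mapP => [[x ->] | [x]].
    exists (paint b tau x); rewrite ?ffunE // mem_enum !inE /paint.
    case: ifP => [hx | ->//]; apply/orP; right; apply/imsetP.
    by exists (cl x); rewrite ?inE.
  rewrite mem_enum !inE => hx ->; exists x; rewrite ffunE /paint; congr nat_of_ord.
  case: ifP => // hb; move: hx; rewrite hb => /imsetP[j _ ->]; by rewrite tauK.
have dis : [set x | gr (cl x) \notin b] :&: [set tau j | j in [set j | gr j \in b]] = set0.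
  apply/setP => x; rewrite !inE; apply/andP => -[hx /imsetP[j]]; rewrite inE => hj e.
  by rewrite e tauK hj in hx.
rewrite cardsU dis cards0 subn0 card_imset // (bigID (mem b)) /= addnC.
congr addn; last first.
  rewrite -[LHS]sum1dep_card (partition_big (fun x => gr (cl x)) (fun c => c \notin b)) //=.
  apply: eq_bigr => c hc; rewrite (negPf hc) -sum1dep_card; apply: eq_bigl => x.
  by case: eqP => [->|]; rewrite ?andbF ?hc.
rewrite -[LHS]sum1dep_card (partition_big gr (fun c => c \in b)) //=.
apply: eq_bigr => c hc; rewrite hc -sum1dep_card; apply: eq_bigl => x.
by case: eqP => [->|]; rewrite ?andbF ?hc.
Qed.

Lemma cl_swap b w i :
  w.1 \in sections -> cl ((swap_draws b w).2 i) = cl (w.2 i).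
Proof. by rewrite inE => /forallP h; rewrite ffunE; case: ifP => // _; apply/eqP. Qed.

Lemma swap_sections b w :
  w.1 \in sections -> (swap_draws b w).1 \in sections.
Proof.
rewrite !inE => /forallP h; apply/forallP => j; rewrite ffunE; case: ifP => // _.
by case: pickP => // i.
Qed.

Lemma hidden_swap b w :
  w.1 \in sections ->
  hidden_groups (swap_draws b w).2 = hidden_groups w.2.
Proof.
move=> hw; apply/setP => c; rewrite !inE; apply: eq_forallb => i; apply: eq_forallb => j.
by rewrite !cl_swap.
Qed.

(** The exchange keeps every draw in its cluster, so the hidden groups do not change. A hidden
    cluster is hit at most once, so [pick] returns that very draw and a second exchange undoes the
    first. *)
Lemma swap_drawsK b w :
  w.1 \in sections -> swap_draws b (swap_draws b w) = w.
Proof.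
move=> hw; case: w hw => tau s hw.
have hs := @hidden_swap b (tau, s) hw.
have hc i : cl ((swap_draws b (tau, s)).2 i) = cl (s i) := @cl_swap b (tau, s) i hw.
rewrite {1}/swap_draws hs; congr pair; apply/ffunP => z; rewrite [LHS]ffunE.
  rewrite (eq_pick (Q := fun i => cl (s i) == z)); last by move=> i; rewrite hc.
  case: ifP => hz; last by rewrite ffunE hz.
  case: pickP => [i /eqP hi | none]; last first.
    by rewrite ffunE hz; case: pickP => // i; rewrite /= none.
  by rewrite ffunE /= hi hz.
rewrite hc; case: ifP => hz; last by rewrite ffunE /= hz.
rewrite ffunE /= hz; case: pickP => [i /eqP hi | /(_ z)]; last by rewrite /= eqxx.
by move: hz; rewrite inE => /andP[_ hz]; rewrite (hidden_groupsP hz (esym hi)).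
Qed.

(** After the exchange a hidden monochromatic cluster carries the colour of the ball originally
    drawn from it, exactly what a rainbow cluster would have shown. *)
Lemma observe_swap b w :
  w.1 \in sections ->
  observe (painted_urn b (swap_draws b w).1) (swap_draws b w).2 =
  observe (painted_urn (b :\: hidden_groups w.2) w.1) w.2.
Proof.
move=> hw; apply/ffunP => i; rewrite !ffunE /paint; congr nat_of_ord.
have e : (if gr (cl (w.2 i)) \in b :&: hidden_groups w.2 then w.1 (cl (w.2 i)) else w.2 i)
    = (swap_draws b w).2 i by rewrite ffunE.
rewrite e cl_swap // -e in_setD in_setI.
case hb: (gr (cl (w.2 i)) \in b); last by rewrite andbF.
rewrite /= andbT ffunE in_setI hb /=.
case hh: (gr (cl (w.2 i)) \in hidden_groups w.2) => //=.
case: pickP => [j /eqP hj | /(_ i)]; last by rewrite /= eqxx.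
by rewrite (hidden_groupsP hh (esym hj)).
Qed.

End Swap.

(** * Failure counts averaged over the random urns *)

Lemma card_all_sets (T : finType) : #|{: {set T}}| = 2 ^ #|T|.
Proof.
rewrite -[in RHS]cardsT -card_powerset -[LHS]cardsT; apply: eq_card => A.
by rewrite !inE subsetT.
Qed.

Lemma card_samples k n : #|{: {ffun 'I_n -> 'I_k}}| = k ^ n.
Proof. by rewrite card_ffun !card_ord. Qed.

Lemma fail_prob_leE k n d u est : 0 < k ->
  (@fail_prob k n d u est <= 1 / 10%:R)%R =
  (10 * #|[set s | d <= `|(est (observe u s) - (num_colors u)%:Z)%R|]| <= k ^ n).
Proof.
move=> k0; rewrite /fail_prob card_samples.
rewrite ler_pdivrMr ?ltr0n ?expn_gt0 ?k0 // mulrAC ler_pdivlMr ?ltr0n //.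
by rewrite mul1r -natrM ler_nat mulnC.
Qed.

(** Failures are counted over all bits, sections and samples. Each urn fails on at most a tenth of
    the samples. After reindexing by [swap_draws] the estimate ignores the hidden bits, so each
    sample with enough hidden groups fails for at least [2/7] of the bit choices; such samples thus
    make up at most [7/20]. *)
Lemma achievable_hidden_groups k n d g W (J Gt : finType) (cl : 'I_k -> J) (gr : J -> Gt)
    (A0 : {set Gt}) (tau0 : {ffun J -> 'I_k}) :
  0 < k -> tau0 \in sections cl ->
  (forall c, c \in A0 -> #|[set x | gr (cl x) == c]| = #|[set j | gr j == c]| + g) ->
  2 * d <= g * W + 1 -> achievable k d n ->
  20 * #|[set s : {ffun 'I_n -> 'I_k} | 2 * W ^ 2 <= #|A0 :&: hidden_groups cl gr s|.+1]|
    <= 7 * k ^ n.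
Proof.
move=> k0 htau0 hA0 hd [est hest]; set E := [set s | _].
pose C (b : {set Gt}) := \sum_c (if c \in b then #|[set j | gr j == c]| else #|[set x | gr (cl x) == c]|).
pose fl b (w : {ffun J -> 'I_k} * {ffun 'I_n -> 'I_k}) :=
  (d <= `|(est (observe (painted_urn cl gr b w.1) w.2)
           - (num_colors (painted_urn cl gr b w.1))%:Z)%R|)%N.
pose S := sections cl.
pose N := \sum_(b : {set Gt}) \sum_(w | w.1 \in S) fl b w.
have cS : 0 < #|S| by apply/card_gt0P; exists tau0.
have NU : 10 * N <= 2 ^ #|Gt| * (#|S| * k ^ n).
  rewrite /N big_distrr /=.
  apply: (@leq_trans (\sum_(b : {set Gt}) #|S| * k ^ n)); last first.
    by rewrite sum_nat_const card_all_sets.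
  apply: leq_sum => b _.
  rewrite (eq_bigl (fun w => (w.1 \in S) && xpredT w.2)); last by move=> w; rewrite andbT.
  rewrite (eq_bigr (fun w => nat_of_bool (fl b (w.1, w.2)))); last by case.
  rewrite -(pair_big (mem S) xpredT (fun tau s => nat_of_bool (fl b (tau, s)))) /=.
  rewrite big_distrr -sum_nat_const /=; apply: leq_sum => tau _.
  have := hest (painted_urn cl gr b tau); rewrite fail_prob_leE // => h.
  apply: leq_trans h; rewrite leq_mul2l /= -sum1dep_card [X in _ <= X]big_mkcond /=.
  by apply: leq_sum => s _; rewrite /fl /=; case: ifP.
have NS b : \sum_(w | w.1 \in S) fl b w = \sum_(w | w.1 \in S) fl b (swap_draws cl gr b w).
  rewrite (reindex_onto (swap_draws cl gr b) (swap_draws cl gr b)) /=; last first.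
    by move=> w hw; apply: swap_drawsK.
  apply: eq_bigl => w; apply/andP/idP => [[h1 /eqP h2] | h].
    by rewrite -h2; apply: swap_sections.
  by split; [apply: swap_sections | apply/eqP; apply: swap_drawsK].
have NL : 2 * 2 ^ #|Gt| * (#|S| * #|E|) <= 7 * N.
  rewrite /N (eq_bigr _ (fun b _ => NS b)) exchange_big /=.
  rewrite (eq_bigl (fun w => (w.1 \in S) && xpredT w.2)); last by move=> w; rewrite andbT.
  rewrite (eq_bigr (fun w => \sum_b nat_of_bool (fl b (swap_draws cl gr b (w.1, w.2))))); last by case.
  rewrite -(pair_big (mem S) xpredT
    (fun tau s => \sum_b nat_of_bool (fl b (swap_draws cl gr b (tau, s))))) /=.
  rewrite mulnCA big_distrr -sum_nat_const /=; apply: leq_sum => tau htau.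
  rewrite mulnC -sum_nat_const big_distrr /= [X in _ <= X](bigID (mem E)) /=.
  apply: leq_trans (leq_addr _ _); apply: leq_sum => s; rewrite inE => hs.
  set H := hidden_groups cl gr s in hs *.
  pose F b := est (observe (painted_urn cl gr (b :\: H) tau) s).
  have hF b : F b = F (b :\: (A0 :&: H)).
    by rewrite /F setDDl (setUidPr (subsetIr _ _)).
  have hC (b : {set Gt}) : C b + g * #|b :&: (A0 :&: H)| = C (b :\: (A0 :&: H)).
    rewrite /C mulnC -sum_nat_const [X in _ + X]big_mkcond -big_split /=.
    apply: eq_bigr => c _; rewrite in_setD in_setI.
    case: (boolP (c \in A0 :&: H)) => [|_]; last by rewrite andbF addn0.
    by rewrite in_setI => /andP[/hA0 -> _]; case: (c \in b); rewrite ?addn0.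
  have := anticoncentration hF hC hd hs.
  set succ := [set b | _] => hsucc.
  have efl b : fl b (swap_draws cl gr b (tau, s)) = (b \notin succ).
    rewrite /fl observe_swap // num_colors_painted ?swap_sections //.
    by rewrite inE -leqNgt.
  have -> : \sum_b nat_of_bool (fl b (swap_draws cl gr b (tau, s))) = #|~: succ|.
    rewrite -sum1_card [RHS]big_mkcond /=; apply: eq_bigr => b _.
    by rewrite efl in_setC; case: (b \in succ).
  have := cardsC succ; rewrite card_all_sets => e2.
  move: hsucc e2; clear; move: #|succ| #|~: succ| (2 ^ _)%N => x y z; lia.
have : 2 ^ #|Gt| * #|S| * (20 * #|E|) <= 2 ^ #|Gt| * #|S| * (7 * k ^ n) by lia.
by rewrite leq_pmul2l // muln_gt0 expn_gt0 cS.
Qed.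

(** * Lower bounds from collisions and from unhit pairs *)

Definition redraw k n (s : {ffun 'I_n -> 'I_k}) (i : 'I_n) (x : 'I_k) : {ffun 'I_n -> 'I_k} :=
  [ffun l => if l == i then x else s l].

(** Resampling one draw preserves the uniform measure: trading the old value of draw [i] for the new
    one is an involution on pairs. *)
Lemma card_redraw k n (i : 'I_n) (P : pred {ffun 'I_n -> 'I_k}) :
  k * #|[set s | P s]| = \sum_s #|[set x | P (redraw s i x)]|.
Proof.
transitivity (\sum_s \sum_x nat_of_bool (P (redraw s i x))); last first.
  by apply: eq_bigr => s _; rewrite -sum1dep_card [RHS]big_mkcond /=; apply: eq_bigr => x _; case: (P _).
rewrite pair_big /= (reindex_onto
  (fun w : {ffun 'I_n -> 'I_k} * 'I_k => (redraw w.1 i w.2, w.1 i))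
  (fun w : {ffun 'I_n -> 'I_k} * 'I_k => (redraw w.1 i w.2, w.1 i))) /=; last first.
  case=> s x _ /=; rewrite /redraw ffunE eqxx; congr pair; apply/ffunP => l; rewrite !ffunE.
  by case: eqP => [->|].
have back s x : redraw (redraw s i x) i (s i) = s.
  by apply/ffunP => l; rewrite !ffunE; case: eqP => [->|].
rewrite (eq_big xpredT (fun w => nat_of_bool (P w.1))); last 2 first.
- case=> s x /=; rewrite back; apply/eqP; congr pair; by rewrite ffunE eqxx.
- by case=> s x _ /=; rewrite back.
rewrite -(pair_big xpredT xpredT (fun s (x : 'I_k) => nat_of_bool (P s))) /=.
under eq_bigr do rewrite sum_nat_const card_ord.
by rewrite -big_distrr /= -sum1dep_card [in LHS]big_mkcond; congr muln; apply: eq_bigr => s _; case: (P s).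
Qed.

(** The mean number of ordered pairs of draws sharing a cluster is at most [n ^ 2 * M / k <= q / 2].
    By Markov's inequality, on at least half of the samples fewer than [q] groups of [A0] are
    exposed, leaving at least [2 * W ^ 2 - 1] hidden ones; but [1/2] exceeds the permitted
    [7/20]. *)
Lemma not_achievable_collisions k n d g W q M (J Gt : finType) (cl : 'I_k -> J)
    (gr : J -> Gt) (A0 : {set Gt}) (tau0 : {ffun J -> 'I_k}) :
  0 < k -> tau0 \in sections cl ->
  (forall c, c \in A0 -> #|[set x | gr (cl x) == c]| = #|[set j | gr j == c]| + g) ->
  (forall j, #|[set x | cl x == j]| <= M) ->
  2 * d <= g * W + 1 -> 0 < q -> 2 * W ^ 2 + q <= #|A0| + 2 -> 2 * n ^ 2 * M <= q * k ->
  ~ achievable k d n.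
Proof.
move=> k0 htau hA0 hM hd q0 hW hn /(achievable_hidden_groups k0 htau hA0 hd).
set E := [set s | _] => hE.
pose coll (i j : 'I_n) (s : {ffun 'I_n -> 'I_k}) := (i != j) && (cl (s i) == cl (s j)).
pose bad (s : {ffun 'I_n -> 'I_k}) := A0 :\: hidden_groups cl gr s.
have bad_le s : #|bad s| <= \sum_i \sum_j coll i j s.
  rewrite pair_big /= -(@big_mkcond _ _ addn _ _ (fun p => coll p.1 p.2 s) (fun=> 1)) sum1dep_card.
  pose f (p : 'I_n * 'I_n) := gr (cl (s p.1)).
  apply: leq_trans (leq_imset_card f _); apply: subset_leq_card; apply/subsetP => c.
  rewrite !inE => /andP[/forallPn[i /forallPn[j]]].
  rewrite negb_imply negbK => /andP[hij /eqP hc] _.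
  by apply/imsetP; exists (i, j); rewrite ?inE.
have coll_le i j : k * #|[set s | coll i j s]| <= M * k ^ n.
  rewrite /coll; case: (eqVneq i j) => [->|ne].
    by rewrite (eq_card (B := set0)) ?cards0 ?muln0 // => s; rewrite !inE.
  rewrite (@card_redraw _ _ i) -(card_samples k n) mulnC -sum_nat_const.
  apply: leq_sum => s _; apply: leq_trans (hM (cl (s j))).
  apply: subset_leq_card; apply/subsetP => x; rewrite !inE !ffunE eqxx.
  by rewrite [j == i]eq_sym (negPf ne).
pose Bad := [set s | q <= #|bad s|].
have h1 : q * #|Bad| <= \sum_i \sum_j #|[set s | coll i j s]|.
  apply: (@leq_trans (\sum_s \sum_i \sum_j coll i j s)).
    rewrite mulnC -sum_nat_const big_mkcond /=; apply: leq_sum => s _.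
    by case: ifP => //; rewrite inE => h; apply: leq_trans h (bad_le s).
  rewrite exchange_big; apply: leq_sum => i _; rewrite exchange_big; apply: leq_sum => j _.
  rewrite -sum1dep_card [X in _ <= X]big_mkcond; apply: leq_sum => s _; by case: (coll _ _ _).
have h2 : k * (q * #|Bad|) <= n ^ 2 * (M * k ^ n).
  apply: (@leq_trans (\sum_(i < n) \sum_(j < n) M * k ^ n)); last first.
    by rewrite !sum_nat_const !card_ord mulnA -mulnn.
  apply: leq_trans (leq_mul (leqnn k) h1) _; rewrite big_distrr; apply: leq_sum => i _.
  by rewrite big_distrr; apply: leq_sum => j _.
have h3 : 2 * #|Bad| <= k ^ n.
  rewrite -(@leq_pmul2l (q * k)) ?muln_gt0 ?q0 //.
  apply: leq_trans (leq_mul hn (leqnn (k ^ n))); move: h2; clear; nia.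
have h4 : k ^ n <= #|E| + #|Bad|.
  rewrite -card_samples -cardsT; apply: leq_trans (leq_card_setU _ _).
  apply: subset_leq_card; apply/subsetP => s _; rewrite !inE /bad.
  have := cardsID (hidden_groups cl gr s) A0; lia.
have : 0 < k ^ n by rewrite expn_gt0 k0.
lia.
Qed.

Lemma card_ord_div N h c : 0 < h -> h * c.+1 <= N -> #|[set x : 'I_N | x %/ h == c]| = h.
Proof.
move=> h0 hN.
have lt (i : 'I_h) : c * h + i < N by have := ltn_ord i; nia.
pose f i := Ordinal (lt i).
have inj : injective f by move=> i j [/addnI/ord_inj].
rewrite -[RHS]card_ord -(card_imset _ inj); apply: eq_card => x; rewrite inE.
apply/eqP/imsetP => [hx | [i _ ->]]; last by rewrite /= divnMDl // divn_small ?addn0.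
by exists (Ordinal (ltn_pmod x h0)) => //; apply: ord_inj; rewrite /= -hx -divn_eq.
Qed.

Lemma not_achievable_birthday k d n : 2 * d < k -> 4 * n ^ 2 <= k - 2 * d -> ~ achievable k d n.
Proof.
move=> hd hn; set m := k - 2 * d in hn.
have m0 : 0 < m by rewrite /m; lia.
have mk : m <= k by rewrite /m; lia.
pose cl (x : 'I_k) := Ordinal (ltn_pmod x m0).
have htau : [ffun j => widen_ord mk j] \in sections cl.
  by rewrite inE; apply/forallP => j; rewrite ffunE -val_eqE /= modn_small.
(* The clusters are the residue classes modulo [m]. The urn has [k] or [k - 2 * d] colours, a gap of
   [2 * d], so [W = 1]; with one group, a single exposed group is already too many, so [q = 1]. *)
apply: (@not_achievable_collisions k n d (2 * d) 1 1 (k %/ m).+1 _ unit cl (fun=> tt) setT _ _ htau).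
- lia.
- by move=> [] _; rewrite !(eq_card (B := predT)) ?card_ord; [rewrite /m; lia | | ] => x; rewrite !inE eqxx.
- move=> j; rewrite -[X in _ <= X]card_ord.
  have lt (x : 'I_k) : x %/ m < (k %/ m).+1 by rewrite ltnS leq_div2r // ltnW.
  apply: (@leq_card_in _ _ (fun x => Ordinal (lt x))) => x y; rewrite !inE -!val_eqE /=.
  by move=> /eqP hx /eqP hy [e]; apply: ord_inj; rewrite (divn_eq x m) (divn_eq y m) e hx hy.
- lia.
- by [].
- by rewrite cardsT card_unit.
- have := leq_trunc_div k m; nia.
Qed.

(** * Clusters of size two *)

Lemma half_lt_uphalf k (x : 'I_k) : x %/ 2 < uphalf k.
Proof. by have := ltn_ord x; lia. Qed.

Definition pair_of k (x : 'I_k) : 'I_(uphalf k) := Ordinal (half_lt_uphalf x).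

(** Index [G] collects the leftover pairs; when [2 * g * G <= k] this includes the singleton cluster
    of an odd [k], so the groups below [G] are complete. *)
Definition pair_group k g G (j : 'I_(uphalf k)) : 'I_G.+1 := inord (minn (j %/ g) G).

Lemma pair_section k : exists tau, tau \in sections (@pair_of k).
Proof.
have lt (j : 'I_(uphalf k)) : 2 * j < k by have := ltn_ord j; lia.
exists [ffun j => Ordinal (lt j)]; rewrite inE; apply/forallP => j.
by rewrite ffunE -val_eqE /= mulKn.
Qed.

Lemma pair_group_eq k g G (j : 'I_(uphalf k)) (c : 'I_G.+1) :
  c < G -> (pair_group g G j == c) = (j %/ g == c :> nat).
Proof.
move=> cG; rewrite -val_eqE /= inordK; last by lia.
by apply/eqP/eqP; lia.
Qed.

Lemma card_pair_group k g G (c : 'I_G.+1) : 0 < g -> 2 * g * G <= k -> c < G ->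
  #|[set x : 'I_k | pair_group g G (pair_of x) == c]| = 2 * g.
Proof.
move=> g0 hk cG; rewrite -[RHS](@card_ord_div k (2 * g) c); try nia.
by apply: eq_card => x; rewrite !inE pair_group_eq //= -divnMA.
Qed.

Lemma pair_group_gap k g G (c : 'I_G.+1) : 0 < g -> 2 * g * G <= k -> c < G ->
  #|[set x : 'I_k | pair_group g G (pair_of x) == c]| =
  #|[set j : 'I_(uphalf k) | pair_group g G j == c]| + g.
Proof.
move=> g0 hk cG; rewrite card_pair_group //.
rewrite (eq_card (B := [set j : 'I_(uphalf k) | j %/ g == c])); last first.
  by move=> j; rewrite !inE pair_group_eq.
rewrite card_ord_div //; first by lia.
suff : 2 * (g * c.+1) <= k by lia.
nia.
Qed.

Lemma card_ord_lt G : #|[set c : 'I_G.+1 | c < G]| = G.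
Proof.
rewrite -sum1dep_card big_mkcond big_ord_recr /= ltnn addn0.
by rewrite (eq_bigr (fun=> 1)) ?sum1_card ?card_ord // => i _; rewrite ltn_ord.
Qed.

Lemma not_achievable_groups k n d g G W q :
  0 < k -> 0 < g -> 2 * g * G <= k ->
  2 * d <= g * W + 1 -> 0 < q -> 2 * W ^ 2 + q <= G + 2 -> 4 * n ^ 2 <= q * k ->
  ~ achievable k d n.
Proof.
move=> k0 g0 hk hd q0 hW hn; have [tau htau] := pair_section k.
apply: (@not_achievable_collisions k n d g W q 2 _ _ (@pair_of k) (pair_group g G)
  [set c : 'I_G.+1 | c < G] _ k0 htau) => //.
- by move=> c; rewrite inE => cG; apply: pair_group_gap.
- move=> j.
  have lt (x : 'I_k) : x %% 2 < 2 by rewrite ltn_mod.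
  rewrite -[X in _ <= X]card_ord.
  apply: (@leq_card_in _ _ (fun x => Ordinal (lt x))) => x y; rewrite !inE -!val_eqE /=.
  by move=> /eqP hx /eqP hy [e]; apply: ord_inj; rewrite (divn_eq x 2) (divn_eq y 2) e hx hy.
- by rewrite card_ord_lt.
- lia.
Qed.

(** * Pairs that no draw hits *)

Lemma card_avoid k n (R : {set 'I_k}) :
  #|[set s : {ffun 'I_n -> 'I_k} | [forall i, s i \in R]]| = #|R| ^ n.
Proof.
rewrite -[in RHS](card_ord n) -card_ffun_on; apply: eq_card => s; rewrite inE.
by apply/forallP/ffun_onP.
Qed.

(* Chebyshev's inequality, multiplied through by [k ^ n] to stay in [nat]; the variance is at
   most the mean because being unhit is negatively correlated between pairs. *)
Lemma unhit_pairs_few k n u : 0 < k ->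
  2 * k ^ n * u <= k./2 * (k - 2) ^ n -> 8 * k ^ n <= k./2 * (k - 2) ^ n ->
  2 * #|[set s : {ffun 'I_n -> 'I_k} |
          #|[set c : 'I_(k./2) | [forall i, s i %/ 2 != c]]| < u]| <= k ^ n.
Proof.
move=> k0; set G := k./2; set T := k ^ n; set p := (k - 2) ^ n => hu h8.
pose unhit (c : 'I_G) (s : {ffun 'I_n -> 'I_k}) := [forall i, s i %/ 2 != c].
pose U s := #|[set c | unhit c s]|.
set Bad := [set s | _].
have T0 : 0 < T by rewrite expn_gt0 k0.
have UE s : U s = \sum_c unhit c s.
  by rewrite /U -sum1dep_card big_mkcond; apply: eq_bigr => c _; case: (unhit c s).
have card1G (c : 'I_G) : #|[set x : 'I_k | x %/ 2 == c :> nat]| = 2.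
  by rewrite card_ord_div //; have := ltn_ord c; rewrite /G; lia.
have N1 c : #|[set s | unhit c s]| = p.
  have -> : p = #|~: [set x : 'I_k | x %/ 2 == c :> nat]| ^ n.
    by congr (_ ^ n); rewrite cardsCs setCK card_ord card1G.
  by rewrite -card_avoid; apply: eq_card => s; rewrite !inE; apply: eq_forallb => i; rewrite !inE.
(* For distinct pairs the negative correlation is [k * (k - 4) <= (k - 2) ^ 2]. *)
have N2 c c' : T * #|[set s | unhit c s && unhit c' s]| <= (c == c') * (T * p) + p ^ 2.
  case: eqVneq => [->|ne].
    rewrite (eq_card (B := [set s | unhit c' s])); last by move=> s; rewrite !inE andbb.
    by rewrite N1 mul1n leq_addr.
  rewrite add0n.
  pose X (c : 'I_G) := [set x : 'I_k | x %/ 2 == c :> nat].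
  have dis : X c :&: X c' = set0.
    apply/setP => x; rewrite !inE; apply/andP => -[/eqP -> ]; by rewrite val_eqE (negPf ne).
  have -> : #|[set s | unhit c s && unhit c' s]| = (k - 4) ^ n.
    have -> : k - 4 = #|~: (X c :|: X c')|.
      by rewrite cardsCs setCK card_ord cardsU dis cards0 !card1G.
    rewrite -card_avoid; apply: eq_card => s; rewrite !inE.
    apply/andP/forallP => [[/forallP h1 /forallP h2] i | h].
      by rewrite !inE negb_or h1 h2.
    by split; apply/forallP => i; have := h i; rewrite !inE negb_or => /andP[].
  rewrite /T /p -expnMn -expnM [n * 2]mulnC expnM; case: (posnP n) => [->//|n0].
  by rewrite leq_exp2r //; nia.
have X1 : \sum_s U s = G * p.
  under eq_bigr do rewrite UE.
  rewrite exchange_big /= -[in RHS](card_ord G) -sum_nat_const; apply: eq_bigr => c _.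
  by rewrite -(N1 c) -sum1dep_card [RHS]big_mkcond; apply: eq_bigr => s _; case: (unhit c s).
have Y1 : T * \sum_s U s ^ 2 <= G * (T * p) + G ^ 2 * p ^ 2.
  have -> : \sum_s U s ^ 2 = \sum_c \sum_c' #|[set s | unhit c s && unhit c' s]|.
    transitivity (\sum_s \sum_c \sum_c' (unhit c s && unhit c' s : nat)).
      apply: eq_bigr => s _; rewrite -mulnn UE big_distrlr /=.
      by apply: eq_bigr => c _; apply: eq_bigr => c' _; case: (unhit c s); case: (unhit c' s).
    rewrite exchange_big; apply: eq_bigr => c _; rewrite exchange_big; apply: eq_bigr => c' _.
    rewrite -sum1dep_card [RHS]big_mkcond; apply: eq_bigr => s _; by case: (_ && _).
  have -> : G * (T * p) + G ^ 2 * p ^ 2 = \sum_(c < G) \sum_(c' < G) ((c == c') * (T * p) + p ^ 2).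
    rewrite (eq_bigr (fun=> T * p + G * p ^ 2)); last first.
      move=> c _; rewrite big_split /= sum_nat_const card_ord (bigD1 c) //= eqxx mul1n.
      by rewrite big1 ?addn0 // => c' /negPf; rewrite eq_sym => ->.
    by rewrite sum_nat_const card_ord; lia.
  rewrite big_distrr; apply: leq_sum => c _; rewrite big_distrr; apply: leq_sum => c' _; exact: N2.
pose m := G * p.
(* This is the square of [T * U s - m]; the subtraction does not truncate, by [nat_Cauchy]. *)
pose D s := (T * U s) ^ 2 + m ^ 2 - 2 * (T * U s * m).
have DE s : D s + 2 * m * T * U s = T ^ 2 * U s ^ 2 + m ^ 2.
  rewrite /D -expnMn -(mulnA _ T) -(mulnA 2 m) (mulnC m); apply: subnK; exact: nat_Cauchy.
have sD : \sum_s D s <= T ^ 2 * m.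
  have : \sum_s (D s + 2 * m * T * U s) = \sum_s (T ^ 2 * U s ^ 2 + m ^ 2).
    by apply: eq_bigr => s _.
  rewrite !big_split /= -!big_distrr /= X1 sum_nat_const card_samples -/T -/m => e.
  have : T * (T * \sum_s U s ^ 2) <= T * (T * m + m ^ 2).
    by rewrite leq_mul2l; apply/orP; right; move: Y1; rewrite /m; lia.
  move: e; move: (\sum_s D s) (\sum_s U s ^ 2) => a y; clear; nia.
have m0 : 0 < m by rewrite /m; lia.
have hB : #|Bad| * m ^ 2 <= 4 * (T ^ 2 * m).
  apply: (@leq_trans (\sum_s 4 * D s)); last by rewrite -big_distrr leq_mul2l sD orbT.
  rewrite -sum_nat_const big_mkcond; apply: leq_sum => s _; case: ifP => //.
  rewrite inE -/(U s) => hs; have := DE s.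
  (* On [Bad] the count is at most half its mean, so the squared deviation is at least
     [m ^ 2 / 4]. *)
  have : 2 * (T * U s) <= m by rewrite /m; nia.
  nia.
have : m * (#|Bad| * m) <= m * (4 * T ^ 2) by nia.
rewrite leq_pmul2l // => hB2.
rewrite -(@leq_pmul2l (4 * T)) ?muln_gt0 ?T0 //.
nia.
Qed.

(** With [g = 1] and [W = 2 * d], about [8 * d ^ 2] hidden pairs suffice. Unhit pairs are hidden,
    and the hypothesis makes their mean number at least twice that. *)
Lemma not_achievable_unhit k n d : 0 < d ->
  16 * d ^ 2 * k ^ n <= k./2 * (k - 2) ^ n -> 0 < k -> ~ achievable k d n.
Proof.
move=> d0 hn k0; have [tau htau] := pair_section k; set G := k./2 in hn.
have hk : 2 * 1 * G <= k by rewrite /G; lia.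
have hgap c : c \in [set c : 'I_G.+1 | c < G] ->
    #|[set x : 'I_k | pair_group 1 G (pair_of x) == c]| =
    #|[set j : 'I_(uphalf k) | pair_group 1 G j == c]| + 1.
  by rewrite inE => cG; apply: pair_group_gap.
have hd : 2 * d <= 1 * (2 * d) + 1 by lia.
move/(achievable_hidden_groups k0 htau hgap hd).
set E := [set s | _] => hE.
have h1 : 2 * k ^ n * (8 * d ^ 2) <= G * (k - 2) ^ n by lia.
have h2 : 8 * k ^ n <= G * (k - 2) ^ n.
  apply: leq_trans hn; rewrite leq_mul2r; apply/orP; right; nia.
have := unhit_pairs_few k0 h1 h2; set Bad := [set s | _] => hB.
have h4 : k ^ n <= #|E| + #|Bad|.
  rewrite -card_samples -cardsT; apply: leq_trans (leq_card_setU _ _).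
  apply: subset_leq_card; apply/subsetP => s _; rewrite !inE.
  rewrite orbC; case: ltnP => //= hU.
  apply: (@leq_trans (8 * d ^ 2)); first by lia.
  apply: leq_trans hU _; apply: leqW.
  pose f (c : 'I_G) : 'I_G.+1 := widen_ord (leqnSn G) c.
  have f_inj : injective f by move=> c c' [] /ord_inj.
  rewrite -(card_imset _ f_inj); apply: subset_leq_card; apply/subsetP => _ /imsetP[c + ->].
  rewrite !inE /= ltn_ord /= => /forallP hc.
  apply/forallP => i; apply/forallP => j; apply/implyP => _.
  by rewrite pair_group_eq /= ?ltn_ord // divn1.
have : 0 < k ^ n by rewrite expn_gt0 k0.
lia.
Qed.

(** * Existence of an achievable sample size and integer bounds on [nstar] *)

Lemma exp_succ_lower a n : n.+1 * a ^ n <= a.+1 ^ n.+1.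
Proof.
elim: n => [|n IH]; first by rewrite expn0 expn1.
rewrite [a.+1 ^ _]expnS mulSn [in X in _ <= X]mulSn; apply: leq_add.
  by rewrite leq_exp2r.
by rewrite expnS mulnCA leq_mul2l IH orbT.
Qed.

(** Counting the observed colours is exact once every ball has been drawn; a union bound over the
    missed ball controls the failures. *)
Lemma exists_achievable k d : 1 < k -> 0 < d -> exists n, achievable k d n.
Proof.
move=> k1 d0; have [n hn] : exists n, 10 * (k * (k - 1) ^ n) <= k ^ n.
  (* With this [n], the factor [n] in [exp_succ_lower] at [a = k - 1] supplies both [10 * k] and the
     missing power of [k - 1]. *)
  exists (10 * k * (k - 1)); have -> : 10 * k * (k - 1) = (10 * k * (k - 1)).-1.+1 by nia.
  set N := _.-1; have := exp_succ_lower (k - 1) N.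
  have -> : (k - 1).+1 = k by lia.
  apply: leq_trans; rewrite expnS.
  have -> : N.+1 = 10 * k * (k - 1) by rewrite /N; nia.
  by rewrite !mulnA.
exists n; exists (fun f => (size (undup (codom f)))%:Z%R) => u.
rewrite fail_prob_leE; last by lia.
apply: leq_trans hn; rewrite leq_mul2l /=.
have sub : [set s : {ffun 'I_n -> 'I_k} |
    d <= `|((size (undup (codom (observe u s))))%:Z - (num_colors u)%:Z)%R|]
    \subset \bigcup_(x : 'I_k) [set s : {ffun 'I_n -> 'I_k} | [forall i, s i \in ~: [set x]]].
  apply/subsetP => s; rewrite inE; apply: contraTT => hs; rewrite -ltnNge.
  suff -> : size (undup (codom (observe u s))) = num_colors u by rewrite subrr.
  apply: perm_size; apply: uniq_perm; rewrite ?undup_uniq // => v; rewrite !mem_undup.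
  apply/codomP/codomP => [[i ->] | [x ->]]; first by exists (s i); rewrite ffunE.
  have : [exists i, s i == x].
    rewrite -[X in is_true X]negbK negb_exists; apply: contra hs => /forallP h.
    by apply/bigcupP; exists x => //; rewrite inE; apply/forallP => i; rewrite !inE h.
  by case/existsP => i /eqP <-; exists i; rewrite ffunE.
apply: leq_trans (subset_leq_card sub) _; apply: leq_trans (leq_card_bigcup _ _) _.
rewrite -[X in X * _](card_ord k) -sum_nat_const; apply: leq_sum => x _.
by rewrite card_avoid cardsC1 card_ord subn1.
Qed.

(** Existence rules out the default value 0 in [nstar]. *)
Lemma nstar_achievable k d : 1 < k -> 0 < d -> achievable k d (nstar k d).
Proof.
move=> k1 d0; rewrite /nstar; case: excluded_middle_informative => [H | []].
  by case: ex_minnP => n; rewrite /achb; case: excluded_middle_informative.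
have [n hn] := exists_achievable k1 d0; exists n.
by rewrite /achb; case: excluded_middle_informative.
Qed.

Lemma nstar_birthday k d : 1 < k -> 0 < d -> 2 * d < k -> k - 2 * d < 4 * nstar k d ^ 2.
Proof.
move=> k1 d0 hd; rewrite ltnNge; apply/negP => h.
exact: (not_achievable_birthday hd h) (nstar_achievable k1 d0).
Qed.

(* The group size [g] is about [256 d^2 / k]: just large enough for the fluctuation of the
   number of colours, [g] times the square root of the [k / (2 g)] groups, to exceed [d]. *)
Lemma nstar_groups k d : 0 < d -> 256 * d <= k ->
  k ^ 3 < 64 * nstar k d ^ 2 * (256 * d ^ 2 + k).
Proof.
move=> d0 hd; have k0 : 0 < k by lia.
set n := nstar k d; have hn : achievable k d n by apply: nstar_achievable; lia.
pose g := (256 * d ^ 2 %/ k).+1.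
have g1 : 256 * d ^ 2 <= k * g.
  by rewrite /g [X in _ <= X]mulnC; apply: ltnW; apply: ltn_ceil.
have g2 : k * g <= 256 * d ^ 2 + k.
  by rewrite /g mulnS addnC leq_add2r mulnC leq_trunc_div.
have g3 : g <= 2 * d.
  suff : 256 * d ^ 2 %/ k <= d by rewrite /g; lia.
  by rewrite -(leq_pmul2r k0); apply: leq_trans (leq_trunc_div _ _) _; nia.
pose W := (2 * d %/ g).+1; pose G := k %/ (2 * g).
have W1 : 2 * d <= g * W by rewrite [X in _ <= X]mulnC; apply: ltnW; apply: ltn_ceil.
have W2 : g * W <= 4 * d.
  rewrite /W mulnS; have := leq_trunc_div (2 * d) g; lia.
have G1 : 2 * g * G <= k by rewrite mulnC leq_trunc_div.
have Gpos : 0 < G by rewrite divn_gt0; lia.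
have G2 : k < 4 * g * G.
  have : k < (G.+1) * (2 * g) by apply: ltn_ceil; lia.
  have : 2 * g * 1 <= 2 * g * G by rewrite leq_mul2l Gpos orbT.
  lia.
have g0 : 0 < g by [].
(* The constant 256 comes from here: [16 (g W)^2 <= 256 d^2 <= k g <= 4 g^2 G]. *)
have WG : 4 * W ^ 2 <= G.
  rewrite -(@leq_pmul2r (4 * g ^ 2)) ?muln_gt0 ?expn_gt0 //.
  have h1 : (g * W) ^ 2 <= (4 * d) ^ 2 by rewrite leq_exp2r.
  have h2 : g * k <= g * (4 * g * G) by rewrite leq_mul2l; apply/orP; right; lia.
  rewrite !expnMn in h1; lia.
have W0 : 0 < W by [].
have W20 : 0 < W ^ 2 by rewrite expn_gt0.
(* Since [2 * W ^ 2 <= G / 2], up to half of the groups may be exposed, hence [q = G./2]. *)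
have hq : G./2 * k < 4 * n ^ 2.
  rewrite ltnNge; apply/negP => h.
  apply: (@not_achievable_groups k n d g G W G./2 k0 g0 G1 _ _ _ h hn); lia.
have h1 : G * k < 16 * n ^ 2.
  have : G * k <= 4 * G./2 * k by rewrite leq_mul2r; apply/orP; right; lia.
  lia.
have h2 : k * k < 64 * g * n ^ 2.
  have h3 : k * k <= 4 * g * G * k by rewrite leq_mul2r (ltnW G2) orbT.
  have h4 : 4 * g * (G * k) < 4 * g * (16 * n ^ 2) by rewrite ltn_pmul2l ?muln_gt0.
  lia.
have h3 : k * (k * k) < k * (64 * g * n ^ 2) by rewrite ltn_pmul2l.
have h4 : 64 * n ^ 2 * (k * g) <= 64 * n ^ 2 * (256 * d ^ 2 + k).
  by rewrite leq_mul2l g2 orbT.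
apply: leq_trans h4; rewrite (_ : k ^ 3 = k * (k * k)) //; lia.
Qed.

Lemma nstar_unhit k d : 1 < k -> 0 < d ->
  k./2 * (k - 2) ^ nstar k d < 16 * d ^ 2 * k ^ nstar k d.
Proof.
move=> k1 d0; rewrite ltnNge; apply/negP => h.
by apply: (not_achievable_unhit d0 h) (nstar_achievable k1 d0); lia.
Qed.

(** * Bounds over the reals *)

Local Open Scope R_scope.

Lemma INR_addn m n : INR (m + n)%N = INR m + INR n.
Proof. exact: plus_INR. Qed.

Lemma INR_muln m n : INR (m * n)%N = INR m * INR n.
Proof. exact: mult_INR. Qed.

Lemma INR_expn m n : INR (m ^ n)%N = INR m ^ n.
Proof. by elim: n => // n IH; rewrite expnS INR_muln IH. Qed.

Lemma INR_subn m n : (n <= m)%N -> INR (m - n)%N = INR m - INR n.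
Proof. by move/leP => h; apply: minus_INR. Qed.

Lemma leq_INR m n : (m <= n)%N -> INR m <= INR n.
Proof. by move/leP; apply: le_INR. Qed.

Lemma ltn_INR m n : (m < n)%N -> INR m < INR n.
Proof. by move/ltP; apply: lt_INR. Qed.

(** * Estimates for [ln], [exp] and [arccosh] *)

Lemma ln_le x y : 0 < x -> x <= y -> ln x <= ln y.
Proof.
by move=> x0 [h | ->]; [left; apply: ln_increasing | right].
Qed.

Lemma arccosh_le_ln y : 1 / 4 <= y -> arccosh (1 + y) <= 2 * ln (1 + 4 * y).
Proof.
move=> hy; rewrite /arccosh.
have s0 := sqrt_pos ((1 + y) * (1 + y) - 1).
have s1 : sqrt ((1 + y) * (1 + y) - 1) <= 1 + y.
  rewrite -{3}(sqrt_square (1 + y)); last lra.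
  by apply: sqrt_le_1_alt; lra.
have -> : 2 * ln (1 + 4 * y) = ln ((1 + 4 * y) * (1 + 4 * y)) by rewrite ln_mult; lra.
by apply: ln_le; nra.
Qed.

Lemma arccosh_ge_ln y : 0 <= y -> / 2 * ln (1 + 4 * y) <= arccosh (1 + y).
Proof.
move=> hy; rewrite /arccosh.
have s1 : y <= sqrt ((1 + y) * (1 + y) - 1).
  rewrite -{1}(sqrt_square y) //.
  by apply: sqrt_le_1_alt; nra.
suff : ln (1 + 4 * y) <= 2 * ln (1 + y + sqrt ((1 + y) * (1 + y) - 1)) by lra.
have -> : forall z, 0 < z -> 2 * ln z = ln (z * z) by move=> z hz; rewrite ln_mult; lra.
  by apply: ln_le; nra.
lra.
Qed.

Lemma ln_le_id z : 0 <= z -> ln (1 + z) <= z.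
Proof.
move=> hz; rewrite -{2}(ln_exp z); apply: ln_le; first lra.
exact: exp_ineq1_le.
Qed.

(** The square root inside is at most [3 t / 4], and [ln (1 + z) <= z] leaves
    [t^2 / 4 + 3 t / 4 <= t]. *)
Lemma arccosh_le_sqrt t : 0 <= t <= 1 -> arccosh (1 + t * t / 4) <= t.
Proof.
move=> ht; rewrite /arccosh.
set z := sqrt _.
have hz : z <= 3 / 4 * t.
  rewrite -(sqrt_square (3 / 4 * t)); last lra.
  apply: sqrt_le_1_alt; rewrite (_ : 3 / 4 * t * (3 / 4 * t) = 9 / 16 * (t * t)); last lra.
  have : 0 <= t * t <= 1 by nra.
  by move: (t * t) => q hq; nra.
have z0 : 0 <= z := sqrt_pos _.
apply: Rle_trans (_ : ln (1 + (t * t / 4 + z)) <= _).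
  by apply: Req_le; congr ln; ring.
by apply: Rle_trans (ln_le_id _) _; nra.
Qed.

(** The square root inside is at least [t / 2], and [exp (t / 4) <= 1 + t / 2] on this range. *)
Lemma arccosh_ge_sqrt t : 0 <= t <= 1 -> / 4 * t <= arccosh (1 + t * t / 4).
Proof.
move=> ht; rewrite /arccosh.
have hz : t / 2 <= sqrt ((1 + t * t / 4) * (1 + t * t / 4) - 1).
  rewrite -{1}(sqrt_square (t / 2)); last lra.
  apply: sqrt_le_1_alt; rewrite (_ : t / 2 * (t / 2) = (t * t) / 4); last lra.
  have : 0 <= t * t <= 1 by nra.
  by move: (t * t) => q hq; nra.
set z := sqrt _ in hz *.
have e : exp (/ 4 * t) <= 1 + t / 2.
  have h := exp_ineq1_le (- (/ 4 * t)).
  have e1 : exp (/ 4 * t) * exp (- (/ 4 * t)) = 1 by rewrite -exp_plus Rplus_opp_r exp_0.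
  have := exp_pos (/ 4 * t); nra.
rewrite -{1}(ln_exp (/ 4 * t)); apply: ln_le; first exact: exp_pos.
nra.
Qed.

Lemma exp_double_opp_le y : 0 <= y <= 1 / 2 -> exp (- (2 * y)) <= 1 - y.
Proof.
move=> hy; have h := exp_ineq1_le (2 * y).
have e1 : exp (- (2 * y)) * exp (2 * y) = 1 by rewrite -exp_plus Rplus_opp_l exp_0.
have := exp_pos (- (2 * y)); nra.
Qed.

Lemma le_of_sqr_le a b : 0 <= b -> a * a <= b * b -> a <= b.
Proof. by move=> b0 h; case: (Rle_lt_dec a b) => //; nra. Qed.

(** * Lower bounds on [nstar] in real form *)

Lemma INR_ge1 n : (0 < n)%N -> 1 <= INR n.
Proof. by move/leq_INR. Qed.

Lemma nstar_birthday_INR k d : (1 < k)%N -> (0 < d)%N -> (2 * d < k)%N ->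
  INR k - 2 * INR d <= 4 * INR (nstar k d) ^ 2.
Proof.
move=> k1 d0 hd; have := leq_INR (ltnW (nstar_birthday k1 d0 hd)).
by rewrite INR_subn ?(ltnW hd) // 2!INR_muln INR_expn (_ : INR 4 = 4) ?INR_IZR_INZ //=; lra.
Qed.

Lemma nstar_groups_INR k d : (0 < d)%N -> (256 * d <= k)%N ->
  INR k ^ 3 <= 64 * INR (nstar k d) ^ 2 * (256 * INR d ^ 2 + INR k).
Proof.
move=> d0 hd; have := leq_INR (ltnW (nstar_groups d0 hd)).
rewrite INR_expn 2!INR_muln INR_addn INR_muln !INR_expn.
have -> : INR 64 = 64 by rewrite INR_IZR_INZ.
by have -> : INR 256 = 256 by rewrite INR_IZR_INZ.
Qed.

(** The birthday bound gives [(k - 2 d)^2 <= k (k - 2 d) <= 4 k n^2]; take square roots. *)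
Lemma nstar_ge_birthday k d : (1 < k)%N -> (0 < d)%N -> (2 * d <= k)%N ->
  (INR k - 2 * INR d) / sqrt (INR k) <= 2 * INR (nstar k d).
Proof.
move=> k1 d0; rewrite leq_eqVlt => /orP[/eqP <- | hd].
  have := pos_INR (nstar (2 * d) d); rewrite INR_muln /= /Rdiv Rminus_diag Rmult_0_l; lra.
have h := nstar_birthday_INR k1 d0 hd.
have K1 := INR_ge1 (ltnW k1).
have D1 := INR_ge1 d0.
have N0 := pos_INR (nstar k d).
have dk := ltn_INR hd; rewrite INR_muln /= in dk.
move: (INR k) (INR d) (INR (nstar k d)) h K1 D1 N0 dk => K D N h K1 D1 N0 dk.
have r0 : 0 < sqrt K by apply: sqrt_lt_R0; lra.
have rr : sqrt K * sqrt K = K by apply: sqrt_sqrt; lra.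
apply: (Rmult_le_reg_r (sqrt K)) => //.
rewrite /Rdiv Rmult_assoc Rinv_l; last lra.
rewrite Rmult_1_r; apply: le_of_sqr_le; first nra.
rewrite (_ : 2 * N * sqrt K * (2 * N * sqrt K) = 4 * N ^ 2 * (sqrt K * sqrt K)); last ring.
by rewrite rr; nra.
Qed.

Lemma nstar_ge_sqrt k d : (0 < d)%N -> (4 * d < k)%N -> sqrt (INR k) <= INR d ->
  INR k * sqrt (INR k) / INR d <= 1000 * INR (nstar k d).
Proof.
move=> d0 hd; have k1 : (1 < k)%N by lia.
have hd2 : (2 * d < k)%N by lia.
have h1 := nstar_birthday_INR k1 d0 hd2.
have h2 : (256 * INR d <= INR k -> INR k ^ 3 <= 64 * INR (nstar k d) ^ 2 * (256 * INR d ^ 2 + INR k)).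
  move=> h; apply: nstar_groups_INR => //; apply/leP/INR_le; rewrite INR_muln.
  by have -> : INR 256 = 256 by rewrite INR_IZR_INZ.
have D1 := INR_ge1 d0.
have N0 := pos_INR (nstar k d).
have dk := ltn_INR hd; rewrite INR_muln (_ : INR 4 = 4) in dk; last by rewrite INR_IZR_INZ.
move: (INR k) (INR d) (INR (nstar k d)) h1 h2 D1 N0 dk => K D N h1 h2 D1 N0 dk hs.
have r0 : 0 <= sqrt K := sqrt_pos _.
have rr : sqrt K * sqrt K = K by apply: sqrt_sqrt; lra.
have KD : K <= D ^ 2 by rewrite -rr; nra.
apply: (Rmult_le_reg_r D); first lra.
rewrite /Rdiv Rmult_assoc Rinv_l ?Rmult_1_r; last lra.
apply: le_of_sqr_le; first nra.
rewrite (_ : K * sqrt K * (K * sqrt K) = K ^ 2 * (sqrt K * sqrt K)); last ring.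
rewrite rr (_ : 1000 * N * D * (1000 * N * D) = 1000000 * (N ^ 2 * D ^ 2)); last ring.
have N2 : 0 <= N ^ 2 by nra.
have D2 : 0 <= D ^ 2 by nra.
have ND : 0 <= N ^ 2 * D ^ 2 by apply: Rmult_le_pos.
(* For [256 * D <= K] the group bound applies. Otherwise [K] and [D] are comparable and the birthday
   bound, with [K - 2 * D >= K / 2], suffices. *)
case: (Rle_lt_dec (256 * D) K) => hK.
  have h3 := h2 hK.
  have h4 : 64 * N ^ 2 * (256 * D ^ 2 + K) <= 64 * N ^ 2 * (257 * D ^ 2).
    by apply: Rmult_le_compat_l; lra.
  lra.
have h3 : K ^ 2 <= 65536 * D ^ 2 by nra.
have h4 : K <= 8 * N ^ 2 by lra.
have h5 : K ^ 2 * K <= (65536 * D ^ 2) * (8 * N ^ 2) by apply: Rmult_le_compat; nra.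
lra.
Qed.

(** From [1 - 2 / k >= exp (- 4 / k)] and [k./2 >= k / 3] the unhit bound becomes
    [k / 3 * exp (- 4 n / k) <= 16 d^2]; the 48 is [3 * 16]. *)
Lemma nstar_unhit_ln k d : (0 < d)%N -> (256 <= k)%N ->
  ln (INR k / (48 * INR d ^ 2)) <= 4 * INR (nstar k d) / INR k.
Proof.
move=> d0 hk; have k1 : (1 < k)%N by lia.
set n := nstar k d.
have h := leq_INR (ltnW (nstar_unhit k1 d0)); rewrite -/n in h.
rewrite 3!INR_muln !INR_expn INR_subn // in h.
have e16 : INR 16 = 16 by rewrite INR_IZR_INZ.
have half : INR k / 3 <= INR k./2.
  have : (k <= 3 * k./2)%N by lia.
  by move/leq_INR; rewrite INR_muln /=; lra.
have K256 := leq_INR hk; rewrite (_ : INR 256 = 256) in K256; last by rewrite INR_IZR_INZ.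
have D1 := INR_ge1 d0.
have e2 : INR 2 = 2 by [].
rewrite e16 e2 in h.
have step : INR k ^ n * exp (- (4 * INR n / INR k)) <= (INR k - 2) ^ n.
  have -> : exp (- (4 * INR n / INR k)) = exp (- (2 * (2 / INR k))) ^ n.
    rewrite -Rpower_pow; last exact: exp_pos.
    by rewrite /Rpower ln_exp; congr exp; field; lra.
  rewrite -Rpow_mult_distr; apply: pow_incr; split.
    by apply: Rmult_le_pos; [lra | apply/Rlt_le/exp_pos].
  apply: Rle_trans (Rmult_le_compat_l _ _ _ _ (exp_double_opp_le _)) _; first lra.
    split; first by apply: Rmult_le_pos; [lra | left; apply: Rinv_0_lt_compat; lra].
    by apply: (Rmult_le_reg_r (INR k)); [lra | rewrite /Rdiv Rmult_assoc Rinv_l; lra].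
  by right; field; lra.
have P0 : 0 < INR k ^ n by apply: pow_lt; lra.
have E0 := exp_pos (- (4 * INR n / INR k)).
have D2 : 0 < INR d ^ 2 by nra.
have key : INR k / 3 * exp (- (4 * INR n / INR k)) <= 16 * INR d ^ 2.
  apply: (Rmult_le_reg_l (INR k ^ n)) => //.
  apply: Rle_trans (_ : INR k / 3 * (INR k ^ n * exp (- (4 * INR n / INR k))) <= _).
    by right; ring.
  apply: Rle_trans (Rmult_le_compat_l _ _ _ _ step) _; first lra.
  apply: Rle_trans (Rmult_le_compat_r _ _ _ _ half) _; first by apply: pow_le; lra.
  lra.
rewrite -(ln_exp (4 * INR n / INR k)); apply: ln_le.
  by apply: Rdiv_lt_0_compat; lra.
apply: (Rmult_le_reg_r (48 * INR d ^ 2)); first lra.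
rewrite /Rdiv Rmult_assoc Rinv_l; last lra.
have e1 : exp (4 * INR n / INR k) * exp (- (4 * INR n / INR k)) = 1.
  by rewrite -exp_plus Rplus_opp_r exp_0.
have E1 := exp_pos (4 * INR n / INR k).
have := Rmult_le_compat_l _ _ _ (Rlt_le _ _ E1) key.
rewrite (_ : exp (4 * INR n / INR k) * (INR k / 3 * exp (- (4 * INR n / INR k)))
  = INR k / 3 * (exp (4 * INR n / INR k) * exp (- (4 * INR n / INR k)))); last ring.
by rewrite e1 /Rdiv; lra.
Qed.

Lemma nstar_ge_ln k d : (0 < d)%N -> (4 * d < k)%N -> INR d <= sqrt (INR k) ->
  INR k * ln (1 + INR k / INR d ^ 2) <= 4294967296 * INR (nstar k d).
Proof.
move=> d0 hd; have k1 : (1 < k)%N by lia.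
have hd2 : (2 * d < k)%N by lia.
have h1 := nstar_birthday_INR k1 d0 hd2.
have D1 := INR_ge1 d0.
have dk := ltn_INR hd; rewrite INR_muln (_ : INR 4 = 4) in dk; last by rewrite INR_IZR_INZ.
have N1 : 1 <= INR (nstar k d).
  apply: INR_ge1; have := nstar_birthday k1 d0 hd2; case: (nstar k d) => //; lia.
have h3 := @nstar_unhit_ln k d d0.
have h2 := @nstar_groups_INR k d d0.
have e256 : INR 256 = 256 by rewrite INR_IZR_INZ.
have {}h2 : 256 * INR d <= INR k -> INR k ^ 3 <= 64 * INR (nstar k d) ^ 2 * (256 * INR d ^ 2 + INR k).
  by move=> h; apply: h2; apply/leP/INR_le; rewrite INR_muln e256.
have {}h3 : 256 <= INR k -> ln (INR k / (48 * INR d ^ 2)) <= 4 * INR (nstar k d) / INR k.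
  by move=> h; apply: h3; apply/leP/INR_le; rewrite e256.
move: (INR k) (INR d) (INR (nstar k d)) h1 h2 h3 D1 N1 dk => K D N h1 h2 h3 D1 N1 dk hs.
have r0 : 0 <= sqrt K := sqrt_pos _.
have rr : sqrt K * sqrt K = K by apply: sqrt_sqrt; lra.
have DK : D ^ 2 <= K by rewrite -rr; nra.
have D2 : 1 <= D ^ 2 by nra.
have xE : K / D ^ 2 * D ^ 2 = K by field; lra.
have x1 : 1 <= K / D ^ 2 by apply: (Rmult_le_reg_r (D ^ 2)); lra.
have lx := ln_le_id (Rle_trans _ _ _ Rle_0_1 x1).
have xK : K / D ^ 2 <= K by nra.
(* If [K < 256 * D], then [D ^ 2 <= K] forces [K <= 65536], and the left side is at most
   [K ^ 2 <= 2 ^ 32]; this and [N >= 1] fix the constant. *)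
case: (Rle_lt_dec (256 * D) K) => hK; last first.
  have : K <= 65536 by nra.
  nra.
have K3 := h2 hK.
have KN : K <= 129 * N.
  apply: le_of_sqr_le; first lra.
  apply: (Rmult_le_reg_r K); first lra.
  have : 64 * N ^ 2 * (256 * D ^ 2 + K) <= 64 * N ^ 2 * (257 * K).
    by apply: Rmult_le_compat_l; nra.
  have : 0 <= N ^ 2 * K by apply: Rmult_le_pos; nra.
  lra.
(* For a bounded ratio the logarithm is bounded and [K <= 129 * N] suffices. Beyond [2304 = 48 ^ 2],
   the ratio [x] satisfies [x <= (x / 48) ^ 2], so the factor 48 costs only a constant. *)
case: (Rle_lt_dec (K / D ^ 2) 2304) => hx.
  have : K * ln (1 + K / D ^ 2) <= K * 2304 by apply: Rmult_le_compat_l; lra.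
  lra.
have K256 : 256 <= K by lra.
have {}h3 := h3 K256.
have e48 : K / (48 * D ^ 2) = K / D ^ 2 / 48 by field; lra.
rewrite e48 in h3.
move: (K / D ^ 2) x1 hx h3 => x x1 hx h3.
have l4 : ln (1 + x) <= 4 * ln (x / 48).
  have -> : 4 * ln (x / 48) = ln ((x / 48) ^ 4) by rewrite ln_pow; [rewrite INR_IZR_INZ | lra].
  apply: ln_le; first lra.
  have q : x <= (x / 48) ^ 2 by nra.
  have -> : (x / 48) ^ 4 = (x / 48) ^ 2 * (x / 48) ^ 2 by ring.
  nra.
have : K * ln (1 + x) <= K * (4 * (4 * N / K)) by apply: Rmult_le_compat_l; lra.
rewrite (_ : K * (4 * (4 * N / K)) = 16 * N); last by field; lra.
lra.
Qed.

Theorem theorem3 :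
  (exists c : R, 0 < c /\
     forall k d : nat, (2 <= k)%N -> (1 <= d)%N ->
       ((2 * d <= k)%N ->
          c * ((INR k - 2 * INR d) / sqrt (INR k)) <= INR (nstar k d)) /\
       ((4 * d < k)%N ->
          c * (INR k * arccosh (1 + INR k / (4 * INR d ^ 2))) <= INR (nstar k d)))
  /\
  (exists c1 c2 : R, 0 < c1 /\ 0 < c2 /\
     forall k d : nat, (2 <= k)%N -> (1 <= d)%N ->
       (INR d <= sqrt (INR k) ->
          c1 * (INR k * ln (1 + INR k / INR d ^ 2))
            <= INR k * arccosh (1 + INR k / (4 * INR d ^ 2))
          /\ INR k * arccosh (1 + INR k / (4 * INR d ^ 2))
            <= c2 * (INR k * ln (1 + INR k / INR d ^ 2))) /\
       (sqrt (INR k) <= INR d ->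
          c1 * (INR k * sqrt (INR k) / INR d)
            <= INR k * arccosh (1 + INR k / (4 * INR d ^ 2))
          /\ INR k * arccosh (1 + INR k / (4 * INR d ^ 2))
            <= c2 * (INR k * sqrt (INR k) / INR d))).
Proof.
have cmp : forall k d : nat, (2 <= k)%N -> (1 <= d)%N ->
   (INR d <= sqrt (INR k) ->
      / 4 * (INR k * ln (1 + INR k / INR d ^ 2))
        <= INR k * arccosh (1 + INR k / (4 * INR d ^ 2))
      /\ INR k * arccosh (1 + INR k / (4 * INR d ^ 2))
        <= 2 * (INR k * ln (1 + INR k / INR d ^ 2))) /\
   (sqrt (INR k) <= INR d ->
      / 4 * (INR k * sqrt (INR k) / INR d)
        <= INR k * arccosh (1 + INR k / (4 * INR d ^ 2))
      /\ INR k * arccosh (1 + INR k / (4 * INR d ^ 2))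
        <= 2 * (INR k * sqrt (INR k) / INR d)).
  move=> k d /ltnW/INR_ge1 K1 /INR_ge1 D1.
  move: (INR k) (INR d) K1 D1 => K D K1 D1.
  have r0 : 0 <= sqrt K := sqrt_pos _.
  have rr : sqrt K * sqrt K = K by apply: sqrt_sqrt; lra.
  have D2 : 1 <= D ^ 2 by nra.
  split=> hs.
    have DK : D ^ 2 <= K by rewrite -rr; nra.
    have e4 : K / (4 * D ^ 2) = K / D ^ 2 / 4 by field; lra.
    have xE : K / D ^ 2 * D ^ 2 = K by field; lra.
    have x1 : 1 <= K / D ^ 2 by apply: (Rmult_le_reg_r (D ^ 2)); lra.
    rewrite e4; move: (K / D ^ 2) x1 => x x1.
    have e5 : 4 * (x / 4) = x by field.
    have hu := @arccosh_le_ln (x / 4); rewrite e5 in hu.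
    have hl := @arccosh_ge_ln (x / 4); rewrite e5 in hl.
    have l0 : 0 <= ln (1 + x) by rewrite -ln_1; apply: ln_le; lra.
    have {}hu : arccosh (1 + x / 4) <= 2 * ln (1 + x) by apply: hu; lra.
    have {}hl : / 2 * ln (1 + x) <= arccosh (1 + x / 4) by apply: hl; lra.
    by split; nra.
  (* In this variable the argument of [arccosh] is [1 + t^2 / 4] and the target rate is [K * t]. *)
  pose t := sqrt K / D.
  have tD : t * D = sqrt K by rewrite /t; field; lra.
  have t0 : 0 <= t <= 1 by split; nra.
  have -> : K / (4 * D ^ 2) = t * t / 4 by rewrite -{1}rr /t; field; lra.
  have -> : K * sqrt K / D = K * t by rewrite /t; field; lra.
  have hu := arccosh_le_sqrt t0; have hl := arccosh_ge_sqrt t0.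
  by split; nra.
split; last by exists (/ 4), 2; split; [lra | split; [lra | exact: cmp]].
(* This is [2 ^ (-33)]: [2 ^ 32] from the logarithmic regime and 2 from comparing [arccosh] with
   [ln]. *)
exists (/ 8589934592); split; first lra.
move=> k d k2 d1; have N0 := pos_INR (nstar k d); split=> hd.
  by have := nstar_ge_birthday k2 d1 hd; lra.
have [c1 c2] := cmp k d k2 d1.
case: (Rle_lt_dec (INR d) (sqrt (INR k))) => hs.
  have [_ h] := c1 hs; have := nstar_ge_ln d1 hd hs; lra.
have hs' := Rlt_le _ _ hs.
have [_ h] := c2 hs'; have := nstar_ge_sqrt d1 hd hs'; lra.
Qed.
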